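(* Let $(V,\mu)$ be a simple, strongly connected, finite weighted directed graph. For $K>0$ and $\Lambda\geq 1$, assume $\inf_{x\neq y}\kappa(x,y)\geq K$ (infimum over all $x,y\in V$ with $x\neq y$) and $\sup_{x\in V}\mathcal{D}_x\leq\Lambda$. Then for every $1$-Lipschitz function $f:V\to\mathbb{R}$ and every $r\geq 0$, $$\mathfrak{m}(\{x\in V : f(x)\geq \mathfrak{m}(f)+r\})\leq e^{-\frac{Kr^2}{\Lambda^2}},$$ where $\mathfrak{m}(f):=\sum_{x\in V}f(x)\mathfrak{m}(x)$.
   Context: A finite weighted directed graph $(V,\mu)$ is a finite set $V$ with an edge weight $\mu:V\times V\to[0,\infty)$, $\mu_{xy}:=\mu(x,y)$ (not necessarily symmetric); write $x\to y$ iff $\mu_{xy}>0$. It is simple if $\mu_{xx}=0$ for all $x$, and strongly connected if for any $x,y\in V$ there is a directed path $x=x_0\to x_1\to\dots\to x_l=y$. The (non-symmetric) distance $d(x,y)$ is the minimal length $l$ of a directed path from $x$ to $y$. The neighborhood of $x$ is $\mathcal{N}_x:=\{y\in V: x\to y\text{ or }y\to x\}$. Set $\mathcal{D}(x,y):=\max\{d(x,y),d(y,x)\}$ and $\mathcal{D}_x:=\sup_{y\in\mathcal{N}_x}\mathcal{D}(x,y)$. Lipschitz constant: $\mathrm{Lip} f:=\sup_{x\neq y}\frac{f(y)-f(x)}{d(x,y)}$; $f$ is $1$-Lipschitz if $\mathrm{Lip} f\leq1$. Transition kernels: $P(x,y):=\mu_{xy}/\mu(x)$ with $\mu(x):=\sum_{y\in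 V}\mu_{xy}>0$. The Perron measure $\mathfrak{m}:V\to(0,1]$ is the unique probability measure with $\mathfrak{m}(x)=\sum_{y\in V}\mathfrak{m}(y)P(y,x)$; for $\Omega\subset V$, $\mathfrak{m}(\Omega):=\sum_{x\in\Omega}\mathfrak{m}(x)$. Put $\overleftarrow{P}(x,y):=\frac{\mathfrak{m}(y)}{\mathfrak{m}(x)}P(y,x)$ and $\mathcal{P}:=\frac12(P+\overleftarrow{P})$. Wasserstein distance: for probability measures $\nu_0,\nu_1$ on $V$, $W(\nu_0,\nu_1):=\inf_{\pi}\sum_{x,y\in V}d(x,y)\pi(x,y)$, the infimum being over all couplings, i.e. probability measures $\pi$ on $V\times V$ with $\sum_y\pi(x,y)=\nu_0(x)$ and $\sum_x\pi(x,y)=\nu_1(y)$. Ricci curvature: for $\epsilon\in[0,1]$ let $\nu^\epsilon_x(z):=(1-\epsilon)\delta_x(z)+\epsilon\,\mathcal{P}(x,z)$, with $\delta_x(z)=1$ if $z=x$ and $0$ otherwise; for $x\ne y$ let $\kappa_\epsilon(x,y):=1-\frac{W(\nu^\epsilon_x,\nu^\epsilon_y)}{d(x,y)}$ and $\kappa(x,y):=\lim_{\epsilon\to0^+}\kappa_\epsilon(x,y)/\epsilon$ (this limit is known to exist). *)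

(* Defs.v *)
From HB Require Import structures.
From mathcomp Require Import all_boot all_order all_algebra.
From mathcomp Require Import all_classical all_reals all_analysis.

Set Implicit Arguments.
Unset Strict Implicit.
Unset Printing Implicit Defensive.

Import Order.TTheory GRing.Theory Num.Theory.
Import numFieldNormedType.Exports.

Local Open Scope classical_set_scope.
Local Open Scope ring_scope.

Section Digraph.
Context {R : realType} {V : finType}.
Implicit Types (mu : V -> V -> R) (m nu f : V -> R) (x y z : V).

Definition edge_weight mu : Prop := forall x y, 0 <= mu x y.

Definition dedge mu : rel V := fun x y => 0 < mu x y.

Definition simple_graph mu : Prop := forall x, mu x x = 0.

Definition dipath mu x y (n : nat) : bool :=
  [exists p : n.-tuple V, path (dedge mu) x p && (last x p == y)].

Definition strongly_connected mu : Prop := forall x y, exists n, dipath mu x y n.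

(* The value 0 when no path exists is never used on a strongly connected graph. *)
Definition dist mu x y : nat :=
  if pselect (exists n, dipath mu x y n) is left h then ex_minn h else 0%N.

Definition nbhd mu x : {set V} := [set y | dedge mu x y || dedge mu y x]%SET.

Definition sym_dist mu x y : nat := maxn (dist mu x y) (dist mu y x).

Definition nbhd_radius mu x : nat := \max_(y in nbhd mu x) sym_dist mu x y.

(* Extended-real suprema and infima, so that the ones over an empty index set
   have their usual values -oo and +oo. *)
Definition Lip mu f : \bar R :=
  ereal_sup [set ((f p.2 - f p.1) / (dist mu p.1 p.2)%:R)%:E
            | p in [set p : V * V | p.1 != p.2]].

Definition one_Lipschitz mu f : Prop := (Lip mu f <= 1)%E.

Definition prob nu : Prop := (forall x, 0 <= nu x) /\ \sum_x nu x = 1.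

Definition vertex_weight mu x : R := \sum_y mu x y.

Definition trans mu x y : R := mu x y / vertex_weight mu x.

Definition perron mu m : Prop :=
  prob m /\ forall x, m x = \sum_y m y * trans mu y x.

Definition mass m (A : {set V}) : R := \sum_(x in A) m x.

Definition mean m f : R := \sum_x f x * m x.

Definition back_trans mu m x y : R := m y / m x * trans mu y x.

Definition mean_trans mu m x y : R := 2^-1 * (trans mu x y + back_trans mu m x y).

Definition coupling nu0 nu1 (pi : V -> V -> R) : Prop :=
  [/\ (forall x y, 0 <= pi x y),
      \sum_x \sum_y pi x y = 1,
      (forall x, \sum_y pi x y = nu0 x)
    & (forall y, \sum_x pi x y = nu1 y)].

Definition Wasserstein mu nu0 nu1 : R :=
  inf [set \sum_x \sum_y (dist mu x y)%:R * pi x y | pi in coupling nu0 nu1].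

Definition lazy_walk mu m (eps : R) x z : R :=
  (1 - eps) * (z == x)%:R + eps * mean_trans mu m x z.

Definition curvature_eps mu m (eps : R) x y : R :=
  1 - Wasserstein mu (lazy_walk mu m eps x) (lazy_walk mu m eps y)
      / (dist mu x y)%:R.

Definition curvature mu m x y : R :=
  lim (curvature_eps mu m eps x y / eps @[eps --> 0^'+]).

Definition inf_curvature mu m : \bar R :=
  ereal_inf [set (curvature mu m p.1 p.2)%:E
            | p in [set p : V * V | p.1 != p.2]].

End Digraph.

(* Main.v *)
(* Run the heat flow of the reversible kernel in small discrete steps e.  By the
   curvature bound, one step maps an L-Lipschitz function h to a
   (1 - e K') L-Lipschitz one for any K' < K, with the same mean.  By convexity
   of exp, reversibility, and
   (exp b - exp a) (b - a) <= (b - a)^2 (exp a + exp b) / 2,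
   it multiplies the mean of exp h by at least 1 - e L^2 Lambda^2 / 2.
   Iterating to the constant limit and letting e -> 0 gives
   m(exp h) <= exp (m(h) + C L^2) for every C > Lambda^2 / (4 K); then apply
   Markov's inequality to exp (l f) with l = 2 K r / Lambda^2. *)

Require Import Defs.
From HB Require Import structures.
From mathcomp Require Import all_boot all_order all_algebra.
From mathcomp Require Import all_classical all_reals all_analysis.
From mathcomp Require Import ring lra.

Set Implicit Arguments.
Unset Strict Implicit.
Unset Printing Implicit Defensive.

Import Order.TTheory GRing.Theory Num.Theory.
Import numFieldNormedType.Exports.
Local Open Scope ring_scope.

(** * Elementary inequalities for the exponential *)

(** The difference of the two sides vanishes at 0, and its derivative [1 + (u - 1) * expR u] is
    nonnegative because [1 - u <= expR (- u)]. *)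
Lemma expR_trapezoid_ge0 (R : realType) (t : R) :
  0 <= t -> 2 * (expR t - 1) <= t * (expR t + 1).
Proof.
rewrite le_eqVlt => /orP[/eqP <-|t0]; first by rewrite expR0; lra.
pose g (u : R) : R := u * (expR u + 1) - 2 * (expR u - 1).
pose dg (u : R) : R := 1 + (u - 1) * expR u.
have dgP (u : R) : is_derive u (1 : R) g (dg u).
  rewrite /g /dg; apply: is_derive_eq.
  by rewrite /GRing.scale /=; ring.
have dg_ge0 u : 0 <= dg u.
  have : (1 - u) * expR u <= expR (- u) * expR u.
    by rewrite ler_wpM2r ?expR_ge0// expR_ge1Dx.
  by rewrite -expRD addNr expR0 /dg; lra.
have [|c _] := @MVT _ g dg 0 t t0 (fun x _ => dgP x).
  apply: derivable_within_continuous => x _.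
  exact: (@ex_derive _ _ _ _ _ _ _ (dgP x)).
have := mulr_ge0 (dg_ge0 c) (ltW t0).
have -> : g 0 = 0 by rewrite /g expR0; ring.
by rewrite !subr0 => ? gt; rewrite -subr_ge0 -/(g t) gt.
Qed.

(** The trapezoid rule overestimates the integral of the convex exponential. Symmetry allows
    [a <= b]; then [expR a] factors out. *)
Lemma expR_trapezoid (R : realType) (a b : R) :
  (expR b - expR a) * (b - a) <= (b - a) ^+ 2 * (expR a + expR b) / 2.
Proof.
wlog ab : a b / a <= b => [H|].
  by have [/H//|/ltW/H] := leP a b; lra.
have -> : expR b = expR a * expR (b - a) by rewrite -expRD addrC subrK.
set t := b - a; have t0 : 0 <= t by rewrite subr_ge0.
have := ler_wpM2l (mulr_ge0 (expR_ge0 a) t0) (expR_trapezoid_ge0 t0).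
by lra.
Qed.

(** Averaging each summand with its transpose turns the left side into half the sum of
    [(expR (h y) - expR (h x)) * (h y - h x)] against [w], where the trapezoid inequality applies
    termwise. *)
Lemma dirichlet_expR_le (R : realType) (V : finType) (w : V -> V -> R)
    (h : V -> R) (B : R) :
  (forall x y, 0 <= w x y) -> (forall x y, w x y = w y x) ->
  (forall x y, w x y != 0 -> (h y - h x) ^+ 2 <= B) ->
  - (\sum_x \sum_y w x y * (expR (h x) * (h y - h x))) <=
  B / 2 * \sum_x \sum_y w x y * expR (h x).
Proof.
move=> w0 ws wB.
have symm (F : V -> V -> R) :
    \sum_x \sum_y w x y * F x y = \sum_x \sum_y w x y * ((F x y + F y x) / 2).
  transitivity ((\sum_x \sum_y w x y * F x y + \sum_x \sum_y w x y * F y x) / 2).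
    rewrite [X in _ + X]exchange_big /=.
    under [X in _ + X]eq_bigr do under eq_bigr do rewrite ws.
    by field.
  rewrite -big_split mulr_suml; apply: eq_bigr => x _ /=.
  rewrite -big_split mulr_suml; apply: eq_bigr => y _ /=.
  by field.
rewrite symm (symm (fun x _ => expR (h x))) -sumrN mulr_sumr ler_sum// => x _.
rewrite -sumrN mulr_sumr ler_sum// => y _.
have [->|/wB hB] := eqVneq (w x y) 0; first by rewrite !mul0r oppr0 mulr0.
rewrite -mulrN [X in _ <= X]mulrCA ler_wpM2l//.
have := expR_trapezoid (h x) (h y).
have := ler_wpM2r (addr_ge0 (expR_ge0 (h x)) (expR_ge0 (h y))) hB.
by lra.
Qed.

(** Moves the factor lost in one step into the exponent: [1 / (1 - a) = 1 + a / (1 - a)] is at most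
    [expR (a / (1 - a))]. *)
Lemma expR_bernoulli (R : realType) (a : R) :
  a < 1 -> expR (- (a / (1 - a))) <= 1 - a.
Proof.
move=> a1; rewrite expRN -[X in _ <= X]invrK lef_pV2 ?posrE ?expR_gt0 ?invr_gt0 ?subr_gt0//.
apply: le_trans (expR_ge1Dx _); rewrite le_eqVlt; apply/orP; left; apply/eqP.
by field; rewrite subr_eq0 gt_eqF.
Qed.

Lemma expR_le_add (R : realType) (M y : R) :
  (forall e, 0 < e -> M <= expR (y + e)) -> M <= expR y.
Proof.
move=> H; have [M0|M0] := leP M 0; first exact: le_trans M0 (expR_ge0 _).
rewrite -[M]lnK ?posrE// ler_expR; apply/ler_addgt0Pr => e /H.
by rewrite -{1}[M]lnK ?posrE// ler_expR.
Qed.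

(** * The distance, the Perron measure and the reversible kernel *)

Section StronglyConnected.
Local Open Scope classical_set_scope.
Local Open Scope ring_scope.
Context {R : realType} {V : finType} (mu : V -> V -> R) (m : V -> R).
Hypotheses (hmu : edge_weight mu) (hconn : strongly_connected mu).
Hypothesis hm : perron mu m.

Lemma dipath_dist x y : dipath mu x y (dist mu x y).
Proof.
rewrite /dist; case: pselect => [h|/(_ (hconn x y))//].
by case: ex_minnP.
Qed.

Lemma dist_refl x : dist mu x x = 0%N.
Proof.
rewrite /dist; case: pselect => [h|//]; case: ex_minnP => n _ /(_ 0%N).
by rewrite leqn0 => H; apply/eqP/H/existsP; exists [tuple] => /=.
Qed.

Lemma dist_gt0 x y : x != y -> (0 < dist mu x y)%N.
Proof.
move=> xy; rewrite lt0n; apply: contra xy => /eqP d0.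
have := dipath_dist x y; rewrite d0 => /existsP[p].
by rewrite (tuple0 p).
Qed.

Lemma vertex_weight_ge0 x : 0 <= vertex_weight mu x.
Proof. by apply: sumr_ge0 => y _; exact: hmu. Qed.

Lemma trans_ge0 x y : 0 <= trans mu x y.
Proof. by rewrite divr_ge0 ?hmu// vertex_weight_ge0. Qed.

Lemma dedge_trans x y : dedge mu x y = (trans mu x y != 0).
Proof.
rewrite /dedge /trans; have := hmu x y; rewrite le_eqVlt => /orP[/eqP <-|xy].
  by rewrite mul0r eqxx ltxx.
rewrite xy mulf_neq0 ?invr_neq0// gt_eqF//.
rewrite /vertex_weight (bigD1 y)//= ltr_pwDl//.
by apply: sumr_ge0 => z _; exact: hmu.
Qed.

(** In the Perron equation a zero of [m] forces zeros at all predecessors; by strong connectivity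
    [m] would vanish everywhere, against total mass 1. *)
Lemma perron_gt0 x : 0 < m x.
Proof.
have [[m0 m1] mP] := hm; rewrite lt_neqAle m0 andbT eq_sym.
apply/negP => /eqP mx0.
have mpred y z : m z = 0 -> dedge mu y z -> m y = 0.
  move=> mz yz; have /eqP := mP z; rewrite mz eq_sym psumr_eq0; last first.
    by move=> u _; rewrite mulr_ge0 ?trans_ge0.
  move/allP/(_ y); rewrite mem_index_enum => /(_ isT).
  by rewrite mulf_eq0; move: yz; rewrite dedge_trans => /negPf -> /=; rewrite orbF => /eqP.
have mpath (p : seq V) y : path (dedge mu) y p -> m (last y p) = 0 -> m y = 0.
  elim: p y => [|z p IH] y //= /andP[yz zp] /(IH _ zp) mz.
  exact: mpred mz yz.
suff m_eq0 y : m y = 0.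
  by move: m1; rewrite big1 => // /eqP; rewrite eq_sym oner_eq0.
have /existsP[p /andP[yp /eqP lp]] := dipath_dist y x.
by apply: mpath yp _; rewrite lp.
Qed.

(* Even a vertex with no outgoing edge is excluded: it would lose mass under
   the Perron equation. *)
Lemma sum_trans x : \sum_y trans mu x y = 1.
Proof.
have [[m0 m1] mP] := hm.
have row_le z : \sum_y trans mu z y <= 1.
  rewrite -mulr_suml; have [->|/mulfV ->//] := eqVneq (vertex_weight mu z) 0.
  by rewrite invr0 mulr0.
have : \sum_z m z * (1 - \sum_y trans mu z y) = 0.
  transitivity (\sum_z m z - \sum_z \sum_y m y * trans mu y z).
    rewrite [X in _ - X]exchange_big /= -sumrB; apply: eq_bigr => z _.
    by rewrite mulrBr mulr1 mulr_sumr.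
  by rewrite -sumrB big1// => z _; rewrite -mP subrr.
move/eqP; rewrite psumr_eq0; last first.
  by move=> z _; rewrite mulr_ge0// subr_ge0.
move/allP/(_ x); rewrite mem_index_enum => /(_ isT).
by rewrite mulf_eq0 gt_eqF ?perron_gt0//= subr_eq0 => /eqP.
Qed.

Lemma sum_back_trans x : \sum_y back_trans mu m x y = 1.
Proof.
have [_ mP] := hm.
rewrite /back_trans; under eq_bigr do rewrite mulrAC.
by rewrite -mulr_suml -mP divff// gt_eqF// perron_gt0.
Qed.

Lemma mean_trans_ge0 x y : 0 <= mean_trans mu m x y.
Proof.
rewrite mulr_ge0// addr_ge0 ?trans_ge0// mulr_ge0 ?trans_ge0//.
by rewrite divr_ge0// ltW ?perron_gt0.
Qed.

Lemma sum_mean_trans x : \sum_y mean_trans mu m x y = 1.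
Proof. by rewrite -mulr_sumr big_split /= sum_trans sum_back_trans; field. Qed.

Lemma mean_trans_reversible x y :
  m x * mean_trans mu m x y = m y * mean_trans mu m y x.
Proof.
rewrite /mean_trans /back_trans.
have /negPf mx := lt0r_neq0 (perron_gt0 x).
have /negPf my := lt0r_neq0 (perron_gt0 y).
by field; rewrite mx my.
Qed.

Lemma mean_trans_nbhd x y : mean_trans mu m x y != 0 -> y \in nbhd mu x.
Proof.
apply: contraNT; rewrite inE !dedge_trans negb_or !negbK => /andP[/eqP xy /eqP yx].
by rewrite /mean_trans /back_trans xy yx !mulr0 addr0 mulr0.
Qed.

(** * The lazy walk as one discrete step of the heat flow *)

Lemma prob_lazy_walk (e : R) x : 0 <= e <= 1 -> prob (lazy_walk mu m e x).
Proof.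
move=> /andP[e0 e1]; split=> [z|].
  by rewrite addr_ge0// mulr_ge0 ?subr_ge0 ?mean_trans_ge0.
rewrite big_split /= -[X in X + _]mulr_sumr -[X in _ + X]mulr_sumr sum_mean_trans.
rewrite (bigD1 x)//= eqxx big1 => [|z /negPf ->//].
by rewrite addr0 !mulr1 subrK.
Qed.

Lemma sum_lazy_walk (e : R) (h : V -> R) x :
  \sum_z lazy_walk mu m e x z * h z =
  h x + e * \sum_z mean_trans mu m x z * (h z - h x).
Proof.
rewrite /lazy_walk; under eq_bigr do rewrite mulrDl -(mulrA (1 - e)) -(mulrA e).
rewrite big_split /= -[X in X + _]mulr_sumr -[X in _ + X]mulr_sumr.
have -> : \sum_z (z == x)%:R * h z = h x.
  by rewrite (bigD1 x)//= eqxx mul1r big1 ?addr0// => z /negPf ->; rewrite mul0r.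
under [X in _ = _ + _ * X]eq_bigr do rewrite mulrBr.
rewrite sumrB -mulr_suml sum_mean_trans; ring.
Qed.

Lemma mean_lazy_walk (e : R) (h : V -> R) :
  mean m (fun x => \sum_z lazy_walk mu m e x z * h z) = mean m h.
Proof.
rewrite /mean; under eq_bigr do rewrite sum_lazy_walk mulrDl.
rewrite big_split /= -[RHS]addr0; congr (_ + _).
pose D := \sum_x \sum_z m x * mean_trans mu m x z * (h z - h x).
have D0 : D = 0.
  (* Exchanging the two summation indices and using reversibility flips the sign of [h z - h x]. *)
  suff : D = - D by lra.
  rewrite {1}/D exchange_big /= -sumrN; apply: eq_bigr => x _.
  rewrite -sumrN; apply: eq_bigr => z _.
  by rewrite mean_trans_reversible; ring.
transitivity (e * D); last by rewrite D0 mulr0.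
rewrite mulr_sumr; apply: eq_bigr => x _.
by rewrite !mulr_sumr mulr_suml; apply: eq_bigr => z _; ring.
Qed.

(** * Lipschitz functions, transport and curvature *)

(* The distance is not symmetric, so this only bounds the increase of [h]. *)
Definition lipschitz (L : R) (h : V -> R) : Prop :=
  forall x y, h y - h x <= L * (dist mu x y)%:R.

Lemma one_Lipschitz_scale (l : R) f :
  0 <= l -> one_Lipschitz mu f -> lipschitz l (fun x => l * f x).
Proof.
move=> l0 hf x y; rewrite -mulrBr ler_wpM2l//.
have [->|xy] := eqVneq x y; first by rewrite subrr.
have d0 : 0 < (dist mu x y)%:R :> R by rewrite ltr0n dist_gt0.
rewrite -[leRHS]mul1r -ler_pdivrMr// -lee_fin.
apply: le_trans hf; apply: ereal_sup_ubound.
by exists (x, y).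
Qed.

(** The easy half of Kantorovich duality: integrate the Lipschitz bound against an arbitrary
    coupling. *)
Lemma lipschitz_Wasserstein (L : R) h nu0 nu1 :
  0 < L -> lipschitz L h -> prob nu0 -> prob nu1 ->
  \sum_z nu1 z * h z - \sum_z nu0 z * h z <= L * Wasserstein mu nu0 nu1.
Proof.
move=> L0 hL [p0 s0] [p1 s1].
rewrite mulrC -ler_pdivrMr//; apply: lb_le_inf.
  (* The product coupling shows that the infimum is over a nonempty set. *)
  exists (\sum_x \sum_y (dist mu x y)%:R * (nu0 x * nu1 y)).
  exists (fun x y => nu0 x * nu1 y) => //; split.
  - by move=> x y; rewrite mulr_ge0.
  - by under eq_bigr do rewrite -mulr_sumr s1 mulr1.
  - by move=> x; rewrite -mulr_sumr s1 mulr1.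
  - by move=> y; rewrite -mulr_suml s0 mul1r.
move=> _ [pi [pi0 _ pi1 pi2] <-].
rewrite ler_pdivrMr// mulr_suml.
have -> : \sum_z nu1 z * h z = \sum_x \sum_y pi x y * h y.
  by rewrite exchange_big /=; apply: eq_bigr => y _; rewrite -mulr_suml pi2.
have -> : \sum_z nu0 z * h z = \sum_x \sum_y pi x y * h x.
  by apply: eq_bigr => x _; rewrite -mulr_suml pi1.
rewrite -sumrB ler_sum// => x _.
rewrite -sumrB mulr_suml ler_sum// => y _.
by rewrite -mulrBr mulrAC [leRHS]mulrC ler_wpM2l// mulrC.
Qed.

(* A non-convergent limit would be 0, so a positive bound on the curvature
   forces the limit defining it to exist. *)
Lemma near_Wasserstein_contraction (K K' : R) :
  0 < K -> K' < K -> (K%:E <= inf_curvature mu m)%E ->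
  \forall e \near 0^'+, forall x y, x != y ->
    Wasserstein mu (lazy_walk mu m e x) (lazy_walk mu m e y)
      <= (1 - e * K') * (dist mu x y)%:R.
Proof.
move=> K0 K'K hcurv.
suff H (p : V * V) : \forall e \near 0^'+, p.1 != p.2 ->
    Wasserstein mu (lazy_walk mu m e p.1) (lazy_walk mu m e p.2)
      <= (1 - e * K') * (dist mu p.1 p.2)%:R.
  near=> e; suff He : forall p : V * V, p.1 != p.2 ->
      Wasserstein mu (lazy_walk mu m e p.1) (lazy_walk mu m e p.2)
        <= (1 - e * K') * (dist mu p.1 p.2)%:R by
    move=> x y; exact: (He (x, y)).
  by near: e; exact: filter_forall.
have [p12|p12] := eqVneq p.1 p.2; first by apply: nearW => e; rewrite p12.
have Kp : K <= curvature mu m p.1 p.2.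
  rewrite -lee_fin; apply: le_trans hcurv _.
  by apply: ereal_inf_lbound; exists p.
have cv : cvg (curvature_eps mu m e p.1 p.2 / e @[e --> 0^'+]).
  apply: cvgNpoint; rewrite gt_eqF//; exact: lt_le_trans Kp.
near=> e => _.
have e0 : 0 < e by [].
have d0 : 0 < (dist mu p.1 p.2)%:R :> R by rewrite ltr0n dist_gt0.
have : K' <= curvature_eps mu m e p.1 p.2 / e.
  near: e; apply: (cvgr_ge _ cv); exact: lt_le_trans K'K Kp.
rewrite ler_pdivlMr// /curvature_eps mulrC => hk.
rewrite -ler_pdivrMr//; lra.
Unshelve. all: end_near. Qed.

Lemma lipschitz_lazy_walk (e k L : R) h :
  0 <= e <= 1 ->
  (forall x y, x != y ->
    Wasserstein mu (lazy_walk mu m e x) (lazy_walk mu m e y)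
      <= k * (dist mu x y)%:R) ->
  0 < L -> lipschitz L h ->
  lipschitz (k * L) (fun x => \sum_z lazy_walk mu m e x z * h z).
Proof.
move=> he hW L0 hL x y.
have [->|xy] := eqVneq x y; first by rewrite subrr dist_refl mulr0.
have := lipschitz_Wasserstein L0 hL (prob_lazy_walk x he) (prob_lazy_walk y he).
by move=> /le_trans -> //; rewrite (mulrC k) -mulrA ler_pM2l// hW.
Qed.

(** Bounding the square needs the increments in both directions, hence both distances; this is why
    the radius is built on [sym_dist]. *)
Lemma lipschitz_nbhd (L Lambda : R) h x y :
  0 <= L -> (\max_(x : V) nbhd_radius mu x)%:R <= Lambda ->
  lipschitz L h -> y \in nbhd mu x -> (h y - h x) ^+ 2 <= (L * Lambda) ^+ 2.
Proof.
move=> L0 hrad hL xy.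
have hs : (sym_dist mu x y)%:R <= Lambda.
  apply: le_trans hrad; rewrite ler_nat.
  apply: leq_trans (leq_bigmax x).
  exact: (@leq_bigmax_cond _ (mem (nbhd mu x)) (sym_dist mu x)).
have hxy : h y - h x <= L * Lambda.
  apply: le_trans (hL x y) _; rewrite ler_wpM2l//.
  by apply: le_trans hs; rewrite ler_nat leq_maxl.
have hyx : h x - h y <= L * Lambda.
  apply: le_trans (hL y x) _; rewrite ler_wpM2l//.
  by apply: le_trans hs; rewrite ler_nat leq_maxr.
by rewrite -subr_ge0 subr_sqr mulr_ge0//; lra.
Qed.

(** * Exponential moments along the flow *)

Lemma mean_expR_lazy_walk (e L Lambda : R) h :
  0 <= e -> 0 <= L -> (\max_(x : V) nbhd_radius mu x)%:R <= Lambda ->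
  lipschitz L h ->
  mean m (fun x => expR (h x)) * (1 - e * (L * Lambda) ^+ 2 / 2) <=
  mean m (fun x => expR (\sum_z lazy_walk mu m e x z * h z)).
Proof.
move=> e0 L0 hrad hL.
have [[m0 _] _] := hm.
pose w x y := m x * mean_trans mu m x y.
have wB x y : w x y != 0 -> (h y - h x) ^+ 2 <= (L * Lambda) ^+ 2.
  rewrite mulf_eq0 negb_or => /andP[_ /mean_trans_nbhd].
  exact: lipschitz_nbhd.
have hw : \sum_x \sum_y w x y * expR (h x) = mean m (fun x => expR (h x)).
  apply: eq_bigr => x _.
  by rewrite -mulr_suml -mulr_sumr sum_mean_trans mulr1 mulrC.
have := @dirichlet_expR_le R V w h ((L * Lambda) ^+ 2).
rewrite hw => hdir.
have {hdir}/(ler_wpM2l e0) hdir := hdir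
  (fun x y => mulr_ge0 (m0 x) (mean_trans_ge0 x y)) mean_trans_reversible wB.
(* The middle term replaces the exponential by its tangent at [h x]: the Dirichlet estimate bounds
   it below, convexity bounds it above. *)
apply: (@le_trans _ _ (mean m (fun x => expR (h x)) +
    e * \sum_x \sum_y w x y * (expR (h x) * (h y - h x)))).
  by lra.
rewrite mulr_sumr -big_split ler_sum// => x _ /=.
rewrite sum_lazy_walk expRD.
have := expR_ge1Dx (e * \sum_z mean_trans mu m x z * (h z - h x)).
move=> /(ler_wpM2l (mulr_ge0 (m0 x) (expR_ge0 (h x)))).
have -> : \sum_y w x y * (expR (h x) * (h y - h x)) =
    m x * expR (h x) * \sum_y mean_trans mu m x y * (h y - h x).
  by rewrite mulr_sumr; apply: eq_bigr => y _; rewrite /w; ring.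
by lra.
Qed.

(** A crude start for the iteration, with the sum of all distances standing in for the diameter. *)
Lemma mean_expR_lipschitz (L : R) h : 0 <= L -> lipschitz L h ->
  mean m (fun x => expR (h x)) <=
  expR (mean m h + L * \sum_x \sum_y (dist mu x y)%:R).
Proof.
move=> L0 hL; have [[m0 m1] _] := hm.
rewrite -[leRHS]mulr1 -[X in _ * X]m1 mulr_sumr ler_sum// => x _.
rewrite ler_wpM2r// ler_expR -lerBlDl.
have -> : h x - mean m h = \sum_y m y * (h x - h y).
  rewrite /mean -[h x in LHS]mul1r -m1 mulr_suml -sumrB.
  by apply: eq_bigr => y _; ring.
rewrite mulr_sumr ler_sum// => y _.
have my1 : m y <= 1 by rewrite -m1 (bigD1 y)//= lerDl sumr_ge0.
have : m y * (h x - h y) <= L * (dist mu y x)%:R.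
  apply: le_trans (ler_wpM2l (m0 y) (hL y x)) _.
  by rewrite ler_piMl// mulr_ge0.
move=> /le_trans -> //; rewrite ler_wpM2l//.
by rewrite (bigD1 x)//= lerDl sumr_ge0.
Qed.

(** Induction on [n], replacing [h] by its walk average and [L] by [q * L]. The condition on [a]
    says that the drop in [C * L ^+ 2] pays for one step; the last term is what remains of the crude
    bound. *)
Lemma mean_expR_iter (e q C L0 Lambda : R) :
  0 <= C -> 0 <= e <= 1 -> 0 < q <= 1 ->
  (\max_(x : V) nbhd_radius mu x)%:R <= Lambda ->
  (forall x y, x != y ->
    Wasserstein mu (lazy_walk mu m e x) (lazy_walk mu m e y)
      <= q * (dist mu x y)%:R) ->
  (forall L, 0 < L <= L0 -> let a := e * (L * Lambda) ^+ 2 / 2 in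
    a < 1 /\ a / (1 - a) + C * (q * L) ^+ 2 <= C * L ^+ 2) ->
  forall n L h, 0 < L <= L0 -> lipschitz L h ->
  mean m (fun x => expR (h x)) <=
  expR (mean m h + C * L ^+ 2 +
        q ^+ n * (L * \sum_x \sum_y (dist mu x y)%:R)).
Proof.
move=> C0 he /andP[q0 q1] hrad hW hC; elim=> [|n IH] L h hL hLip.
  have [a1 ha] := hC L hL.
  have /andP[Lgt0 _] := hL.
  apply: le_trans (mean_expR_lipschitz (ltW Lgt0) hLip) _.
  rewrite ler_expR expr0 mul1r lerD2r lerDl.
  by rewrite mulr_ge0 ?sqr_ge0.
have [a1 ha] := hC L hL; have /andP[Lgt0 LL0] := hL.
have /andP[e0 _] := he.
have hqL : 0 < q * L <= L0.
  by rewrite mulr_gt0//=; apply: le_trans LL0; rewrite ler_piMl// ltW.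
have := IH _ _ hqL (lipschitz_lazy_walk he hW Lgt0 hLip).
rewrite mean_lazy_walk => /(le_trans (mean_expR_lazy_walk e0 (ltW Lgt0) hrad hLip)).
set a := e * _ / 2 in a1 ha *; rewrite -ler_pdivlMr ?subr_gt0// => /le_trans; apply.
rewrite ler_pdivrMr ?subr_gt0//.
apply: le_trans (ler_wpM2l (expR_ge0 _) (expR_bernoulli a1)).
rewrite -expRD ler_expR (exprSr q n) -[q ^+ n * q * _]mulrA [q * (L * _)]mulrA.
set b := a / _ in ha *; lra.
Qed.

(* The one-step condition of [mean_expR_iter] only costs a constant
   C > Lambda^2 / (4 K'): as e -> 0, sum_n e q^(2n) / 2 tends to 1 / (4 K'). *)
Lemma near_step_condition (K' C L0 Lambda : R) :
  0 < K' -> Lambda ^+ 2 < 4 * K' * C ->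
  \forall e \near 0^'+, forall L, 0 < L <= L0 ->
    let a := e * (L * Lambda) ^+ 2 / 2 in
    a < 1 /\ a / (1 - a) + C * ((1 - e * K') * L) ^+ 2 <= C * L ^+ 2.
Proof.
(* [T] is chosen so that [e * K' + 2 * a <= e * T] uniformly in [L <= L0]; then
   [(2 - e * K') * (1 - a) >= 2 - e * T]. *)
move=> K0 hC; pose T := K' + (L0 * Lambda) ^+ 2.
have T0 : 0 < T by rewrite ltr_pwDl ?sqr_ge0.
have C0 : 0 < C.
  have := le_lt_trans (sqr_ge0 Lambda) hC.
  by rewrite pmulr_rgt0// mulr_gt0.
near=> e; move=> L /andP[Lgt0 LL0]; set a := e * _ / 2 => /=.
have e0 : 0 < e by [].
have eT1 : e * T < 1.
  by rewrite -ltr_pdivlMr// mul1r; near: e; apply: nbhs_right_lt; rewrite invr_gt0.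
have eT2 : e * (2 * K' * C * T) <= 4 * K' * C - Lambda ^+ 2.
  rewrite -ler_pdivlMr ?mulr_gt0//; near: e; apply: nbhs_right_le.
  by rewrite divr_gt0 ?mulr_gt0// subr_gt0.
have haT : e * K' + 2 * a <= e * T.
  rewrite /T mulrDr lerD2l /a mulrCA divff// mulr1 ler_pM2l// !exprMn.
  by rewrite ler_wpM2r ?sqr_ge0// lerXn2r ?nnegrE ?(le_trans (ltW Lgt0)).
have a0 : 0 <= a by rewrite /a mulr_ge0// mulr_ge0 ?sqr_ge0 ?ltW.
have eK0 : 0 < e * K' by rewrite mulr_gt0.
have a1 : a < 1 by lra.
split=> //; rewrite -lerBrDr ler_pdivrMr ?subr_gt0//.
have eL0 : 0 <= e * L ^+ 2 / 2 by rewrite !mulr_ge0 ?sqr_ge0 ?ltW.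
rewrite [leLHS](_ : _ = e * L ^+ 2 / 2 * Lambda ^+ 2); last by rewrite /a; ring.
apply: (@le_trans _ _ (e * L ^+ 2 / 2 * (2 * K' * C * (2 - e * T)))).
  by rewrite ler_wpM2l//; lra.
have -> : (C * L ^+ 2 - C * ((1 - e * K') * L) ^+ 2) * (1 - a) =
   e * L ^+ 2 / 2 * (2 * K' * C * ((2 - e * K') * (1 - a))) by field.
rewrite ler_wpM2l// ler_wpM2l//; first by rewrite !mulr_ge0 ?ltW.
have := mulr_ge0 (ltW eK0) a0; lra.
Unshelve. all: end_near. Qed.

Lemma mean_expR_le (K Lambda C L : R) h :
  0 < K -> (K%:E <= inf_curvature mu m)%E ->
  (\max_(x : V) nbhd_radius mu x)%:R <= Lambda ->
  0 < C -> Lambda ^+ 2 < 4 * K * C -> 0 < L -> lipschitz L h ->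
  mean m (fun x => expR (h x)) <= expR (mean m h + C * L ^+ 2).
Proof.
move=> K0 hcurv hrad C0 hC L0 hL.
(* The midpoint between [Lambda ^+ 2 / (4 * C)] and [K] leaves strict room on both sides, for the
   contraction and for the step condition. *)
pose K' := (K + Lambda ^+ 2 / (4 * C)) / 2.
have hK : Lambda ^+ 2 / (4 * C) < K.
  by rewrite ltr_pdivrMr ?mulr_gt0//; lra.
have s0 : 0 <= Lambda ^+ 2 / (4 * C) by rewrite divr_ge0 ?sqr_ge0// mulr_ge0 ?ltW.
have K'0 : 0 < K' by rewrite /K'; lra.
have K'K : K' < K by rewrite /K'; lra.
have hC' : Lambda ^+ 2 < 4 * K' * C.
  rewrite mulrAC -ltr_pdivrMl ?mulr_gt0// mulrC /K'; lra.
have [e [[[hW hstep] e0] [e1 eK]]] : exists e : R,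
    (((forall x y, x != y ->
      Wasserstein mu (lazy_walk mu m e x) (lazy_walk mu m e y)
      <= (1 - e * K') * (dist mu x y)%:R) /\
     (forall L', 0 < L' <= L ->
    let a := e * (L' * Lambda) ^+ 2 / 2 in
    a < 1 /\ a / (1 - a) + C * ((1 - e * K') * L') ^+ 2 <= C * L' ^+ 2)) /\
    0 < e) /\ e <= 1 /\ e * K' < 1.
  apply: (@filter_ex _ (0 : R)^'+).
  near=> e; split; [split; [split|] | split].
  - by near: e; exact: near_Wasserstein_contraction hcurv.
  - by near: e; exact: near_step_condition.
  - by [].
  - by near: e; exact: nbhs_right_le.
  - by rewrite -ltr_pdivlMr// mul1r; near: e; apply: nbhs_right_lt; rewrite invr_gt0.
have eK0 : 0 < e * K' by rewrite mulr_gt0.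
have he : 0 <= e <= 1 by rewrite ltW.
have hq : 0 < 1 - e * K' <= 1 by apply/andP; split; lra.
apply: expR_le_add => d d0.
set D := L * \sum_x \sum_y (dist mu x y)%:R.
(* With [e] fixed, the remainder of the crude bound falls below the slack [d] for some [n]. *)
have cvgD : (1 - e * K') ^+ n * D @[n --> \oo] --> 0.
  rewrite -[X in _ --> X](mul0r D); apply: cvgMr_tmp; apply: cvg_expr.
  by rewrite ger0_norm; lra.
have [n hn] : exists n, (1 - e * K') ^+ n * D < d.
  have : \forall n \near \oo, (1 - e * K') ^+ n * D < d.
    exact: cvgr_lt cvgD _ d0.
  by move=> /filter_ex.
have LL : 0 < L <= L by rewrite L0 lexx.
apply: le_trans (mean_expR_iter (ltW C0) he hq hrad hW hstep n LL hL) _.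
by rewrite ler_expR lerD2l ltW.
Unshelve. all: end_near. Qed.

(** * The Chernoff bound and the conclusion *)

Lemma mass_mean_expR (t l : R) (f : V -> R) : 0 <= l ->
  mass m [set x | t <= f x]%SET <=
  expR (- (l * t)) * mean m (fun x => expR (l * f x)).
Proof.
move=> l0; have [[m0 _] _] := hm.
rewrite /mass /mean mulr_sumr big_mkcond ler_sum//= => x _.
rewrite inE; case: ifPn => [tf|_]; last by rewrite !mulr_ge0 ?expR_ge0.
by rewrite mulrA ler_peMl// -expRD -[1]expR0 ler_expR addrC subr_ge0 ler_wpM2l.
Qed.

End StronglyConnected.

Theorem theorem1p2 (R : realType) (V : finType) (mu : V -> V -> R) (m : V -> R)
    (K Lambda : R)
    (hmu : edge_weight mu)
    (hsimple : simple_graph mu)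
    (hconn : strongly_connected mu)
    (hm : perron mu m)
    (hK : 0 < K)
    (hLambda : 1 <= Lambda)
    (hcurv : (K%:E <= inf_curvature mu m)%E)
    (hrad : (\max_(x : V) nbhd_radius mu x)%:R <= Lambda)
    (f : V -> R) (hf : one_Lipschitz mu f)
    (r : R) (hr : 0 <= r) :
  mass m [set x : V | mean m f + r <= f x]%SET
    <= expR (- (K * r ^+ 2 / Lambda ^+ 2)).
Proof.
have [[m0 m1] _] := hm.
have Lam0 : 0 < Lambda by exact: lt_le_trans hLambda.
have s0 : 0 < Lambda ^+ 2 by rewrite exprn_gt0.
(* At [r = 0] the exponent [l] below would vanish, but the bound is then just total mass 1. *)
move: hr; rewrite le_eqVlt => /orP[/eqP <-|r0].
  rewrite expr0n mulr0 mul0r oppr0 expR0 -m1 /mass big_mkcond ler_sum//= => x _.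
  by case: ifP.
(* This [l] minimises [- l * r + Lambda ^+ 2 * l ^+ 2 / (4 * K)], with minimum
   [- K * r ^+ 2 / Lambda ^+ 2]. *)
pose l := 2 * K * r / Lambda ^+ 2.
have l0 : 0 < l by rewrite divr_gt0// !mulr_gt0.
apply: expR_le_add => d d0.
(* The excess over the critical constant contributes exactly [d] to [C * l ^+ 2]. *)
pose C := Lambda ^+ 2 / (4 * K) + d / l ^+ 2.
have c0 : 0 < Lambda ^+ 2 / (4 * K) by rewrite divr_gt0// mulr_gt0.
have d'0 : 0 < d / l ^+ 2 by rewrite divr_gt0// exprn_gt0.
have C0 : 0 < C by rewrite addr_gt0.
have hC : Lambda ^+ 2 < 4 * K * C.
  by rewrite mulrC -ltr_pdivrMr ?mulr_gt0// ltrDl.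
have hmean : mean m (fun x => l * f x) = l * mean m f.
  by rewrite /mean mulr_sumr; apply: eq_bigr => x _; rewrite mulrA.
have := mean_expR_le hmu hconn hm hK hcurv hrad C0 hC l0
  (one_Lipschitz_scale hconn (ltW l0) hf).
move=> /(ler_wpM2l (expR_ge0 (- (l * (mean m f + r))))).
move=> /(le_trans (mass_mean_expR hm (mean m f + r) f (ltW l0))) /le_trans; apply.
rewrite -expRD ler_expR hmean le_eqVlt; apply/orP; left; apply/eqP.
rewrite /C mulrDl divfK ?expf_neq0 ?gt_eqF// /l.
by field; rewrite !gt_eqF.
Qed.
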